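(* Let $(g,f)=(d_{n,k})_{n,k\ge0}$ be a Riordan array with $g(0)=1$. Then, as infinite matrices, $$(g,f)=[g,f]\,\big([1]\oplus(g,f)\big),$$ where $[g,f]$ is the quasi-Riordan array of $g,f$ and $[1]\oplus(g,f)$ is the block-diagonal matrix $\begin{pmatrix}1&0\\0&(g,f)\end{pmatrix}$.
   Context: $\mathbb{K}$ is $\mathbb{R}$ or $\mathbb{C}$. For $g\in\mathbb{K}[[t]]$ with $g(0)=1$ and $f\in\mathbb{K}[[t]]$ with $f(0)=0\ne f'(0)$, the Riordan array $(g,f)=(d_{n,k})_{n,k\ge0}$ is the infinite lower triangular matrix with $d_{n,k}=[t^n]g(t)f(t)^k$ (column $k$ has generating function $gf^k$). The quasi-Riordan array $[g,f]$ is the infinite lower triangular matrix whose $0$th column has generating function $g$ and whose $j$th column, for $j\ge1$, has generating function $t^{j-1}f$; i.e. $[g,f]=(g,f,tf,t^2f,\dots)$. Equivalently, with $f=\sum_{j\ge1}f_jt^j$, $[g,f]$ has first row $(g_0,0,0,\dots)$, and for $n\ge1$ its $n$th row is $(g_n,f_n,f_{n-1},\dots,f_1,0,\dots)$. *)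

(* Defs.v *)
From HB Require Import structures.
From mathcomp Require Import all_boot all_order all_algebra.
From mathcomp Require Import boolp classical_sets functions cardinality fsbigop reals.
From mathcomp Require Import complex.

Set Implicit Arguments.
Unset Strict Implicit.
Unset Printing Implicit Defensive.

Import Order.TTheory GRing.Theory Num.Theory.
Local Open Scope classical_set_scope.
Local Open Scope ring_scope.

Variant scalar_kind := RealScalars | ComplexScalars.

Definition scalars (R : realType) (c : scalar_kind) : fieldType :=
  match c with
  | RealScalars => R
  | ComplexScalars => R[i]
  end.

(* A one-field record rather than a bare function type: [nat -> K] already
   carries the pointwise product as its canonical multiplication. *)
Record fps (K : Type) := Fps { coefs : nat -> K }.

Lemma fpsP (K : Type) (a b : fps K) : (forall n, coefs a n = coefs b n) -> a = b.
Proof. by case: a b => [a] [b] /= ab; congr Fps; apply/funext. Qed.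

HB.instance Definition _ (K : Type) := gen_eqMixin (fps K).
HB.instance Definition _ (K : Type) := gen_choiceMixin (fps K).

Section FpsRing.
Variable K : comNzRingType.
Implicit Types a b c : fps K.

Definition fps_zero : fps K := Fps (fun=> 0).
Definition fps_opp a : fps K := Fps (fun n => - coefs a n).
Definition fps_add a b : fps K := Fps (fun n => coefs a n + coefs b n).
Definition fps_one : fps K := Fps (fun n => (n == 0%N)%:R).
Definition fps_mul a b : fps K :=
  Fps (fun n => \sum_(i < n.+1) coefs a i * coefs b (n - i)%N).

Fact fps_addA : associative fps_add.
Proof. by move=> a b c; apply: fpsP => n; exact: addrA. Qed.
Fact fps_addC : commutative fps_add.
Proof. by move=> a b; apply: fpsP => n; exact: addrC. Qed.
Fact fps_add0 : left_id fps_zero fps_add.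
Proof. by move=> a; apply: fpsP => n; exact: add0r. Qed.
Fact fps_addN : left_inverse fps_zero fps_opp fps_add.
Proof. by move=> a; apply: fpsP => n; exact: addNr. Qed.

HB.instance Definition _ :=
  GRing.isZmodule.Build (fps K) fps_addA fps_addC fps_add0 fps_addN.

Let trunc n a : {poly K} := \poly_(i < n) coefs a i.

Let coef_truncM N n a b : (n < N)%N ->
  (trunc N a * trunc N b)`_n = coefs (fps_mul a b) n.
Proof.
move=> nN; rewrite coefM; apply: eq_bigr => i _.
by rewrite !coef_poly (leq_ltn_trans (leq_subr _ _) nN)
  (leq_ltn_trans _ nN) // -ltnS.
Qed.

Let coef_truncM3 N n a b (p : {poly K}) : (n < N)%N ->
  (trunc N a * trunc N b * p)`_n = (trunc N (fps_mul a b) * p)`_n.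
Proof.
move=> nN; rewrite !coefM; apply: eq_bigr => -[i /=]; rewrite ltnS => ilen _.
by rewrite coef_truncM ?coef_poly ?(leq_ltn_trans ilen nN).
Qed.

Fact fps_mulC : commutative fps_mul.
Proof.
by move=> a b; apply: fpsP => n; rewrite -!(@coef_truncM n.+1) // mulrC.
Qed.
Fact fps_mulA : associative fps_mul.
Proof.
move=> a b c; apply: fpsP => n; have nn := ltnSn n.
rewrite -!(@coef_truncM n.+1) // -coef_truncM3 //.
by rewrite (mulrC (trunc _ a)) -coef_truncM3 // mulrC mulrA.
Qed.
Fact fps_mul1 : left_id fps_one fps_mul.
Proof.
move=> a; apply: fpsP => n /=; rewrite big_ord_recl /= mul1r subn0.
by rewrite big1 ?addr0 // => i _; rewrite mul0r.
Qed.
Fact fps_mulDl : left_distributive fps_mul fps_add.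
Proof.
move=> a b c; apply: fpsP => n /=; rewrite -big_split /=.
by apply: eq_bigr => i _; rewrite mulrDl.
Qed.
Fact fps_one_neq0 : fps_one != 0 :> fps K.
Proof.
by apply/eqP => /(congr1 (fun a => coefs a 0)) /eqP; rewrite /= oner_eq0.
Qed.

HB.instance Definition _ := GRing.Zmodule_isComNzRing.Build (fps K)
  fps_mulA fps_mulC fps_mul1 fps_mulDl fps_one_neq0.

Lemma coefsM a b n :
  coefs (a * b) n = \sum_(i < n.+1) coefs a i * coefs b (n - i)%N.
Proof. by []. Qed.

Definition fpsX : fps K := Fps (fun n => (n == 1%N)%:R).

Definition fps_deriv a : fps K := Fps (fun n => coefs a n.+1 *+ n.+1).

Definition fps_at0 a : K := coefs a 0.

Lemma coefs_fpsXnM j a n :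
  coefs (fpsX ^+ j * a) n = if (n < j)%N then 0 else coefs a (n - j)%N.
Proof.
elim: j n => [|j IHj] n; first by rewrite expr0 mul1r subn0.
rewrite exprS -mulrA coefsM; case: n => [|n].
  by rewrite big_ord_recl big_ord0 /= mul0r addr0.
rewrite 2!big_ord_recl [X in X + _]mul0r add0r mul1r big1 ?addr0; last first.
  by move=> i _; apply: mul0r.
by rewrite lift0 subSS subn0 IHj ltnS subSS.
Qed.

(* Infinite matrices, with rows and columns indexed from 0. *)
Definition inf_matrix := nat -> nat -> K.

Definition lower_triangular (A : inf_matrix) :=
  forall n k, (n < k)%N -> A n k = 0.

(* The sum is over all natural numbers. It is the intended product as soon as
   the rows of A have finite support, in particular if A is lower triangular;
   by convention, [\sum_(k \in setT)] is 0 on a family of infinite support. *)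
Definition inf_mulmx (A B : inf_matrix) : inf_matrix :=
  fun n m => \sum_(k \in [set: nat]) (A n k * B k m).

Lemma inf_mulmxE A B n m : lower_triangular A ->
  inf_mulmx A B n m = \sum_(k < n.+1) A n k * B k m.
Proof.
move=> At; rewrite /inf_mulmx -(fsbig_widen `I_n.+1 setT) /=; last 2 first.
- by [].
- by move=> k [_ /= /negP]; rewrite ltnS -ltnNge => /At ->; rewrite mul0r.
by rewrite -fsbig_ord.
Qed.

Definition one_dsum (A : inf_matrix) : inf_matrix := fun n k =>
  match n, k with
  | 0%N, 0%N => 1
  | n'.+1, k'.+1 => A n' k'
  | _, _ => 0
  end.

Definition riordan_pair (g f : fps K) :=
  [/\ fps_at0 g = 1, fps_at0 f = 0 & fps_at0 (fps_deriv f) <> 0].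

Definition riordan (g f : fps K) : inf_matrix :=
  fun n k => coefs (g * f ^+ k) n.

Definition quasi_riordan (g f : fps K) : inf_matrix := fun n k =>
  match k with
  | 0%N => coefs g n
  | j.+1 => coefs (fpsX ^+ j * f) n
  end.

Lemma riordan_lower_triangular g f :
  fps_at0 f = 0 -> lower_triangular (riordan g f).
Proof.
rewrite /fps_at0 => f0 n k; rewrite /riordan mulrC; elim: k n => // k IHk n.
rewrite ltnS => nk; rewrite exprS -mulrA coefsM big_ord_recl f0 mul0r add0r.
rewrite big1 // => i _; rewrite lift0 IHk ?mulr0 //.
by rewrite (leq_trans _ nk) // ltn_subrL (leq_ltn_trans _ (ltn_ord i)).
Qed.

Lemma quasi_riordan_lower_triangular g f :
  fps_at0 f = 0 -> lower_triangular (quasi_riordan g f).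
Proof.
rewrite /fps_at0 => f0 n [//|j]; rewrite ltnS => nj.
rewrite /quasi_riordan coefs_fpsXnM; case: ltnP => // jn.
by rewrite (eqP (_ : n - j == 0)%N) ?f0 // subn_eq0.
Qed.

Lemma quasi_riordan_row g f n j : (j <= n)%N ->
  quasi_riordan g f n.+1 j.+1 = coefs f (n.+1 - j).
Proof.
by move=> jn; rewrite /quasi_riordan coefs_fpsXnM ltnNge (leq_trans jn (leqnSn n)).
Qed.

Lemma one_dsum_lower_triangular A :
  lower_triangular A -> lower_triangular (one_dsum A).
Proof. by move=> At [|n] [|k] //=; rewrite ltnS; exact: At. Qed.

End FpsRing.

Arguments fps_mul : simpl never.
Arguments quasi_riordan : simpl never.

(* Main.v *)
(** Column [m.+1] of [(g, f)] is generated by [(g f^m) f]. As [f] has no constant term,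
    the coefficient of [t^n] in that product is [\sum_(k < n) (g f^m)_k f_(n - k)],
    where [(g f^m)_k] is the entry [k, m] of [(g, f)] and [f_(n - k)] is the entry
    [n, k.+1] of [[g, f]]. *)

Require Import Defs.
From mathcomp Require Import all_boot all_order all_algebra.
From mathcomp Require Import boolp reals.

Import GRing.Theory.
Local Open Scope ring_scope.

Lemma riordan_quasi_riordan (K : comNzRingType) (g f : fps K) :
  fps_at0 f = 0 ->
  riordan g f = inf_mulmx (quasi_riordan g f) (one_dsum (riordan g f)).
Proof.
(* Lower triangularity makes the sum finite; its term of index 0 is split off. *)
move=> f0; apply/funext => n; apply/funext => -[|m];
  rewrite inf_mulmxE ?big_ord_recl /=; try exact: quasi_riordan_lower_triangular.
  (* Column 0 of the direct sum is a unit vector, so only [coefs g n] survives. *)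
  by rewrite /riordan expr0 !mulr1 big1 ?addr0 // => i _; rewrite mulr0.
(* Here the term of index 0 vanishes, leaving the indices [k.+1] with [k < n]. *)
rewrite mulr0 add0r /riordan exprSr mulrA coefsM big_ord_recr /= subnn.
(* The last term of the Cauchy product has the factor [coefs f 0 = 0], so both sums now range over
   [k < n]. *)
rewrite [coefs f 0]f0 mulr0 addr0; apply: eq_bigr => k _.
by rewrite /bump add1n /quasi_riordan coefs_fpsXnM ltnNge ltnW //= mulrC.
Qed.

Theorem theorem2p4 (R : realType) (c : scalar_kind) (g f : fps (scalars R c)) :
  riordan_pair g f ->
  riordan g f = inf_mulmx (quasi_riordan g f) (one_dsum (riordan g f)).
Proof. by case=> _ f0 _; exact: riordan_quasi_riordan. Qed.
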